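(* Let $M$ and $A=D+Q$ be the finite volume matrices of the multicontinuum problem described in the context, let $A_0=\mathrm{diag}(A_{11},A_{22},\dots,A_{LL})$ be the block-diagonal part of $A$ with respect to the splitting into continua, and let $A_1=A-A_0$. Let $(p^n)_{n\ge0}$ be the solution of the decoupled semi-implicit scheme with time step $\tau>0$ $$M\,\frac{p^n-p^{n-1}}{\tau}+A_0\,p^n+A_1\,p^{n-1}=F^n,\quad n=1,2,\dots,\qquad p^0=p_0 .$$ If $A_0-A_1\ge0$, then the scheme is unconditionally stable: for every $\tau>0$ and every $n\ge1$, $$\|p^n\|_A^2\le\|p^{n-1}\|_A^2+\frac{\tau}{2}\,\|F^n\|^2_{\left(M+\frac{\tau}{2}(A_0-A_1)\right)^{-1}} .$$
   Context: There are $L$ continua. Continuum $\alpha\in\{1,\dots,L\}$ is discretized by a grid with $N^\alpha_h$ cells $\varsigma^\alpha_i$ of measure $|\varsigma^\alpha_i|>0$. The unknown is $p=(p_1,\dots,p_L)$ with $p_\alpha\in\mathbb{R}^{N^\alpha_h}$, so $p\in\mathbb{R}^{N_h}$ with $N_h=\sum_\alpha N^\alpha_h$. The semi-discrete two-point flux finite volume system is $$c_{\alpha,i}|\varsigma^\alpha_i|\frac{\partial p_{\alpha,i}}{\partial t}+\sum_j T_{\alpha,ij}(p_{\alpha,i}-p_{\alpha,j})+\sum_{\beta\ne\alpha}\sum_j\sigma_{\alpha\beta,ij}(p_{\alpha,i}-p_{\beta,j})=f_{\alpha,i}|\varsigma^\alpha_i|,$$ written in matrix form as $M\,\partial_t p+Ap=F$,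 $A=D+Q$. Here $c_{\alpha,i}>0$; $T_{\alpha,ij}=T_{\alpha,ji}\ge0$ are the transmissibilities between neighbouring cells of continuum $\alpha$ (zero for non-neighbouring cells); and $\sigma_{\alpha\beta,ij}=\sigma_{\beta\alpha,ji}\ge0$ are the coupling coefficients (zero if $\varsigma^\alpha_i\cap\varsigma^\beta_j=\emptyset$). The matrices are: $M=\mathrm{diag}(M_1,\dots,M_L)$ with $M_\alpha=\mathrm{diag}(c_{\alpha,i}|\varsigma^\alpha_i|)$; $D=\mathrm{diag}(D_1,\dots,D_L)$, where $D_\alpha$ has diagonal entries $\sum_{n\ne i}T_{\alpha,in}$ and off-diagonal entries $-T_{\alpha,ij}$; $Q$ has off-diagonal blocks $-Q_{\alpha\beta}$ with $Q_{\alpha\beta}=(\sigma_{\alpha\beta,ij})_{ij}=Q_{\beta\alpha}^T$, and its $\alpha$-th diagonal block $S_\alpha$ is the diagonal matrix with entries $\sum_{\beta\ne\alpha}\sum_j\sigma_{\alpha\beta,ij}$. Thus $A_{\alpha\alpha}=D_\alpha+S_\alpha$, and $A_1$ has zero diagonal blocks and off-diagonal blocks $-Q_{\alpha\beta}$. The matrix $A=A_0+A_1$ satisfies $A=A^T\ge0$, and $M$ is symmetric positive definite. $F^n\in\mathbb{R}^{N_h}$ is the right-hand side at time $t_n=n\tau$, and $p_0\in\mathbb{R}^{N_h}$ is given. Notation: $(\cdot,\cdot)$ is the Euclidean scalar product, $B\ge0$ means $(Bv,v)\ge0$ for all $v$, $\|v\|_A^2=(Av,v)$, and $\|v\|_{B^{-1}}^2=(B^{-1}v,v)$.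 *)

(* Defs.v *)
From mathcomp Require Import all_boot all_order all_algebra.
From mathcomp Require Import classical_sets.

Set Implicit Arguments.
Unset Strict Implicit.
Unset Printing Implicit Defensive.

Import Order.TTheory GRing.Theory Num.Theory.
Local Open Scope ring_scope.

(* Grids and coefficients of the two-point flux finite volume method for L
   continua in a space X.  Geometry enters only through the sets [cell], their
   measures [vol] and the relation [neighbor] between cells of one continuum. *)
Record multicontinuum (R : realFieldType) (X : Type) (L : nat) :=
  Multicontinuum {
  ncell : 'I_L -> nat;
  cell : forall a, 'I_(ncell a) -> set X;
  vol : forall a, 'I_(ncell a) -> R;
  neighbor : forall a, rel 'I_(ncell a);
  capacity : forall a, 'I_(ncell a) -> R;
  transm : forall a, 'M[R]_(ncell a);
  (* [coupling a a] is junk: no axiom constrains it and no matrix reads it. *)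
  coupling : forall a b, 'M[R]_(ncell a, ncell b);
  vol_gt0 : forall a (i : 'I_(ncell a)), 0 < vol i;
  capacity_gt0 : forall a (i : 'I_(ncell a)), 0 < capacity i;
  transm_sym : forall a i j, transm a i j = transm a j i;
  transm_ge0 : forall a i j, 0 <= transm a i j;
  transm_supp : forall a i j, ~~ neighbor i j -> transm a i j = 0;
  coupling_sym : forall a b i j, b != a -> coupling a b i j = coupling b a j i;
  coupling_ge0 : forall a b i j, b != a -> 0 <= coupling a b i j;
  coupling_supp : forall a b i j, b != a ->
    (cell i `&` cell j)%classic = set0 -> coupling a b i j = 0
}.

Section Matrices.
Context (R : realFieldType) (X : Type) (L : nat) (P : multicontinuum R X L).

Definition ndof : nat := (\sum_(a < L) ncell P a)%N.

Definition mass_mx : 'M[R]_ndof :=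
  \mxdiag_(a < L) diag_mx (\row_i (capacity i * vol i) : 'rV[R]_(ncell P a)).

Definition diffusion_block (a : 'I_L) : 'M[R]_(ncell P a) :=
  \matrix_(i, j) if i == j then \sum_(k | k != i) transm P a i k
                 else - transm P a i j.

Definition diffusion_mx : 'M[R]_ndof := \mxdiag_(a < L) diffusion_block a.

Definition exchange_diag (a : 'I_L) : 'M[R]_(ncell P a) :=
  diag_mx (\row_i \sum_(b < L | b != a) \sum_j coupling P a b i j).

Definition exchange_mx : 'M[R]_ndof :=
  \mxdiag_(a < L) exchange_diag a
  + \mxblock_(a < L, b < L) (if b != a then - coupling P a b else 0).

Definition system_mx : 'M[R]_ndof := diffusion_mx + exchange_mx.

Definition system_mx0 : 'M[R]_ndof :=
  \mxdiag_(a < L) submxblock system_mx a a.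

Definition system_mx1 : 'M[R]_ndof := system_mx - system_mx0.

End Matrices.

Section EuclideanForms.
Context (R : realFieldType) (n : nat).
Implicit Types (B : 'M[R]_n) (u v : 'cV[R]_n).

Definition dot u v : R := \sum_i u i 0 * v i 0.

(* Symmetry of B is deliberately not part of this notion. *)
Definition psd B : Prop := forall v, 0 <= dot (B *m v) v.

(* Norms in B^-1 are written [normsq (invmx B)]; they are used only for B
   positive definite, where [invmx B] is the true inverse. *)
Definition normsq B v : R := dot (B *m v) v.

End EuclideanForms.

(* p n approximates the solution at time n * tau; F 0 plays no role. *)
Definition semi_implicit_scheme (R : realFieldType) (X : Type) (L : nat)
    (P : multicontinuum R X L) (tau : R) (F : nat -> 'cV[R]_(ndof P))
    (p0 : 'cV[R]_(ndof P)) (p : nat -> 'cV[R]_(ndof P)) : Prop :=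
  p 0%N = p0 /\
  forall n : nat, (1 <= n)%N ->
    mass_mx P *m (tau^-1 *: (p n - p n.-1))
      + system_mx0 P *m p n + system_mx1 P *m p n.-1 = F n.

(* Main.v *)
Require Import Defs.
From mathcomp Require Import all_boot all_order all_algebra.
From mathcomp Require Import ring lra.

(** The scheme is a perturbation of Crank-Nicolson.  With [A = A0 + A1] and
    [w = p^n - p^(n-1)],
    [A0 p^n + A1 p^(n-1) = A (p^n + p^(n-1)) / 2 + (A0 - A1) w / 2],
    so that one step reads
    [G w / tau + A (p^n + p^(n-1)) / 2 = F^n],
    [G = M + (tau / 2) (A0 - A1)].
    Pairing with [w] turns the second term into half the increment of the
    energy [(A v, v)], because [A] is symmetric ([system_mx_sym]).  The first
    term, [(G w, w) / tau], absorbs exactly the quadratic term that appears when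
    [(F^n, w)] is bounded by Young's inequality for the dual norms of [G] and
    [invmx G] ([young_posdef]).

    Young's inequality needs [G] symmetric positive definite.  Symmetry of [A0]
    and [A1] is inherited from that of [A], and positivity comes from the
    diagonal mass matrix ([mass_mx_posdef]) and from the assumption on
    [A0 - A1].  *)

Import Order.TTheory GRing.Theory Num.Theory.
Local Open Scope ring_scope.

Section EuclideanProduct.
Context {R : realFieldType} {n : nat}.
Implicit Types (B : 'M[R]_n) (u v w : 'cV[R]_n).

Lemma dotC u v : dot u v = dot v u.
Proof. by apply: eq_bigr => i _; rewrite mulrC. Qed.

Lemma dotDl u v w : dot (u + v) w = dot u w + dot v w.
Proof. by rewrite -big_split; apply: eq_bigr => i _; rewrite mxE mulrDl. Qed.

Lemma dotZl c u v : dot (c *: u) v = c * dot u v.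
Proof. by rewrite mulr_sumr; apply: eq_bigr => i _; rewrite mxE mulrA. Qed.

Lemma dotZr c u v : dot u (c *: v) = c * dot u v.
Proof. by rewrite !(dotC u) dotZl. Qed.

Lemma dotBl u v w : dot (u - v) w = dot u w - dot v w.
Proof. by rewrite -scaleN1r dotDl dotZl mulN1r. Qed.

Lemma dotBr u v w : dot w (u - v) = dot w u - dot w v.
Proof. by rewrite !(dotC w) dotBl. Qed.

Lemma dotE u v : dot u v = (u^T *m v) 0 0.
Proof. by rewrite mxE; apply: eq_bigr => i _; rewrite mxE. Qed.

Lemma dot_mulmx_sym B u v : B^T = B -> dot (B *m u) v = dot (B *m v) u.
Proof. by move=> symB; rewrite [RHS]dotC !dotE trmx_mul symB mulmxA. Qed.

End EuclideanProduct.

Section PositiveDefinite.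
Context {R : realFieldType} {n : nat}.
Implicit Types (B : 'M[R]_n) (u v : 'cV[R]_n).

Definition posdef B : Prop := forall v, v != 0 -> 0 < dot (B *m v) v.

Lemma posdef_psd B : posdef B -> psd B.
Proof.
move=> posB v; have [->|/posB/ltW //] := eqVneq v 0.
by rewrite /dot big1 // => i _; rewrite [X in _ * X]mxE mulr0.
Qed.

Lemma posdefD_psd B C : posdef B -> psd C -> posdef (B + C).
Proof.
by move=> posB psdC v v0; rewrite mulmxDl dotDl ltr_wpDr ?posB ?psdC.
Qed.

Lemma psdZ c B : 0 <= c -> psd B -> psd (c *: B).
Proof. by move=> c0 psdB v; rewrite -scalemxAl dotZl mulr_ge0 ?psdB. Qed.

(** A vector in the kernel of [B] would have zero energy. *)
Lemma posdef_unitmx B : posdef B -> B \in unitmx.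
Proof.
move=> posB; rewrite -unitmx_tr -row_free_unit; apply/inj_row_free => v vB0.
apply/eqP/negPn/negP; rewrite -trmx_eq0 => /posB.
have -> : B *m v^T = 0 by rewrite -[LHS]trmxK trmx_mul trmxK vB0 trmx0.
by rewrite /dot big1 ?ltxx // => i _; rewrite mxE mul0r.
Qed.

Lemma diag_mx_posdef (d : 'rV[R]_n) :
  (forall i, 0 < d 0 i) -> posdef (diag_mx d).
Proof.
move=> d_gt0 v /cV0Pn [i vi0].
have termE j : (diag_mx d *m v) j 0 * v j 0 = d 0 j * v j 0 ^+ 2.
  by rewrite mul_diag_mx mxE expr2 mulrA.
rewrite /dot (bigD1 i) //= ltr_wpDr //.
  by apply: sumr_ge0 => j _; rewrite termE mulr_ge0 ?sqr_ge0 // ltW.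
by rewrite termE mulr_gt0 // exprn_even_gt0.
Qed.

(** Completing the square: this is the nonnegativity of
    [(B (u - s B^-1 f), u - s B^-1 f)]. *)
Lemma young_posdef B (s : R) (f u : 'cV[R]_n) : B^T = B -> posdef B ->
  s * dot f u *+ 2 <= normsq B u + s ^+ 2 * normsq (invmx B) f.
Proof.
move=> symB posB; have uB := posdef_unitmx _ posB.
rewrite /normsq; set g := invmx B *m f.
have Bg : B *m g = f by rewrite mulKVmx.
have Bsg : B *m (s *: g) = s *: f by rewrite -scalemxAr -[in RHS]Bg.
have := posdef_psd _ posB (u - s *: g).
rewrite mulmxBr Bsg !(dotBl, dotBr, dotZl, dotZr).
rewrite (dot_mulmx_sym _ u g symB) Bg (dotC g f).
lra.
Qed.

End PositiveDefinite.

Section SystemMatrices.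
Context {R : realFieldType} {X : Type} {L : nat} (P : multicontinuum R X L).

Lemma mass_mx_posdef : posdef (mass_mx P).
Proof.
rewrite /mass_mx -diag_mxrow; apply: diag_mx_posdef => i.
by rewrite !mxE mulr_gt0 ?capacity_gt0 ?vol_gt0.
Qed.

Lemma diffusion_block_sym a : (diffusion_block P a)^T = diffusion_block P a.
Proof.
apply/matrixP => i j; rewrite !mxE eq_sym.
by case: eqVneq => [->|_] //; rewrite transm_sym.
Qed.

Lemma system_mx_sym : (system_mx P)^T = system_mx P.
Proof.
rewrite /system_mx /diffusion_mx /exchange_mx !linearD /= !tr_mxdiag tr_mxblock.
congr (_ + (_ + _)).
- by apply: eq_mxdiag => a; rewrite diffusion_block_sym.
- by apply: eq_mxdiag => a; rewrite tr_diag_mx.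
apply: eq_mxblock => a b; rewrite eq_sym.
case: ifP => [ba|_]; last exact: trmx0.
by apply/matrixP => i j; rewrite !mxE coupling_sym // eq_sym.
Qed.

Lemma system_mx0_sym : (system_mx0 P)^T = system_mx0 P.
Proof.
rewrite /system_mx0 tr_mxdiag; apply: eq_mxdiag => a.
by rewrite tr_submxblock system_mx_sym.
Qed.

Lemma system_mx1_sym : (system_mx1 P)^T = system_mx1 P.
Proof. by rewrite linearB /= system_mx_sym system_mx0_sym. Qed.

Lemma mass_mx_sym : (mass_mx P)^T = mass_mx P.
Proof. by rewrite /mass_mx -diag_mxrow tr_diag_mx. Qed.

End SystemMatrices.

(** Symmetry of [B] cancels the two cross terms; this is what makes the midpoint
    part of the step contribute an exact difference of energies. *)
Lemma dot_midpoint_increment (R : realFieldType) n (B : 'M[R]_n)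
    (x y : 'cV[R]_n) : B^T = B ->
  dot (B *m (y + x)) (y - x) = normsq B y - normsq B x.
Proof.
move=> symB; rewrite mulmxDr dotDl !dotBr (dot_mulmx_sym _ x y symB) /normsq.
ring.
Qed.

(** The step in Crank-Nicolson form.  It is multiplied by [2 tau] so that
    pairing it with [y - x] leaves no denominators. *)
Lemma semi_implicit_step_midpoint (R : realFieldType) n (tau : R)
    (M A0 A1 : 'M[R]_n) (x y f : 'cV[R]_n) : tau != 0 ->
  M *m (tau^-1 *: (y - x)) + A0 *m y + A1 *m x = f ->
  2%:R *: ((M + (tau / 2%:R) *: (A0 - A1)) *m (y - x))
    + tau *: ((A0 + A1) *m (y + x)) = (2%:R * tau) *: f.
Proof.
move=> tau0 <-; rewrite -scalemxAr !(mulmxDl, mulmxBr, mulmxDr) -!scalemxAl.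
rewrite !(mulmxBl, mulmxDl).
by apply/matrixP => i j; rewrite !mxE; field.
Qed.

Theorem theorem3 (R : realFieldType) (X : Type) (L : nat)
    (P : multicontinuum R X L)
    (hpsd : psd (system_mx0 P - system_mx1 P))
    (tau : R) (htau : 0 < tau)
    (F : nat -> 'cV[R]_(ndof P)) (p0 : 'cV[R]_(ndof P))
    (p : nat -> 'cV[R]_(ndof P))
    (hp : semi_implicit_scheme tau F p0 p)
    (n : nat) (hn : (1 <= n)%N) :
  normsq (system_mx P) (p n) <=
    normsq (system_mx P) (p n.-1)
    + tau / 2%:R
      * normsq (invmx (mass_mx P
                       + (tau / 2%:R) *: (system_mx0 P - system_mx1 P)))
               (F n).
Proof.
have /(semi_implicit_step_midpoint _ _ _ _ _ _ _ _ _ (lt0r_neq0 htau)) step :=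
  hp.2 n hn.
set G := mass_mx P + _ in step *.
have symG : G^T = G.
  rewrite linearD /= linearZ /= linearB /= mass_mx_sym.
  by rewrite system_mx0_sym system_mx1_sym.
have posG : posdef G.
  by apply: posdefD_psd (mass_mx_posdef P) (psdZ _ _ _ hpsd); lra.
have AE : system_mx0 P + system_mx1 P = system_mx P by rewrite addrC subrK.
rewrite AE in step.
have := congr1 (fun f => dot f (p n - p n.-1)) step.
rewrite dotDl !dotZl dot_midpoint_increment ?system_mx_sym // => energy.
(* With [s = tau / 2] the bound on the work of [F] contains the same multiple
   of [(G w, w)] as the energy balance, so the two cancel. *)
have young :=
  young_posdef G (tau / 2%:R) (F n) (p n - p n.-1) symG posG.
rewrite -(ler_pM2l htau); move: young energy.
rewrite -/(normsq G _); lra.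
Qed.
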